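(* Let $(X,p)$ be a finitely typed generalised partial metric space. If $(x_n)_n$ is a Cauchy sequence in $(X,p)$ and $q=\lim_{n,m\to\infty}p(x_n,x_m)$, then the number $q$ together with the function $$\phi\colon X\to[0,\infty],\quad \phi(y)=\lim_{n\to\infty}p(y,x_n)$$ is a Cauchy presheaf of finite type $q$ on $(X,p)$, whose right adjoint is given by $$\psi\colon X\to[0,\infty],\quad \psi(y)=\lim_{n\to\infty}p(x_n,y).$$ This correspondence is bijective between equivalence classes of Cauchy sequences in $(X,p)$ on the one hand, and Cauchy presheaves (Cauchy distributors) of finite type on $(X,p)$ on the other. Moreover, a Cauchy sequence converges to $x\in X$ (for the categorical topology) if and only if the corresponding Cauchy presheaf is representable by $x$.
   Context: Here $\vee$ denotes the maximum (in the natural order) of elements of $[0,\infty]$. A generalised partial metric space $(X,p)$ is a set $X$ with a function $p\colon X\times X\to[0,\infty]$ such that $p(y,x)\ge p(x,x)\vee p(y,y)$ and $p(z,y)-p(y,y)+p(y,x)\ge p(z,x)$ for all $x,y,z\in X$. It is finitely typed if $p(x,x)<\infty$ for all $x\in X$. Categorical topology: the topology on $X$ with closure operator: $x\in\overline{S}$ iff $p(x,x)\ge\inf_{s\in S}\big(p(x,s)-p(s,s)+p(s,x)\big)$. Cauchy sequences: $(x_n)_n$ in $X$ is Cauchy if $(p(x_n,x_m))_{(n,m)}$ is a Cauchy net in $[0,\infty]$, where $[0,\infty]$ carries the (extended) metric $d_s(a,b)=|a-b|$ if $a,b<\infty$, $d_s(\infty,\infty)=0$, and $d_s(a,b)=\infty$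 otherwise. For $(X,p)$ finitely typed such a net is eventually finite and converges in $[0,\infty[$; moreover, for a Cauchy sequence $(x_n)_n$ and $y\in X$ the sequences $(p(y,x_n))_n$ and $(p(x_n,y))_n$ converge in $[0,\infty]$ (for $d_s$). A sequence $(x_n)_n$ is typed if $\lim_n p(x_n,x_n)$ exists in $[0,\infty[$; Cauchy sequences are typed. Typed sequences $(x_n)_n$, $(y_n)_n$ are equivalent, $(x_n)_n\sim(y_n)_n$, if $\lim_n p(x_n,y_n)=\lim_n p(x_n,x_n)=\lim_n p(y_n,y_n)=\lim_n p(y_n,x_n)$ (all limits existing); this is an equivalence relation. A (contravariant) presheaf of finite type $q\in[0,\infty[$ on $(X,p)$ is a function $\phi\colon X\to[0,\infty]$ with $q\vee p(y,y)\le\phi(y)\le p(y,x)-p(x,x)+\phi(x)$ for all $x,y\in X$. A covariant presheaf of type $q$ is a function $\psi\colon X\to[0,\infty]$ with $q\vee p(y,y)\le\psi(y)\le\psi(x)-p(x,x)+p(x,y)$ for all $x,y\in X$. They are adjoint, $\phi\dashv\psi$ ($\psi$ is the right adjoint of $\phi$), if $\inf_{z\in X}\big(\psi(z)-p(z,z)+\phi(z)\big)\le q$ and $p(y,x)\le\phi(y)-q+\psi(x)$ for all $x,y\in X$. A presheaf $\phi$ of type $q$ is a Cauchy presheaf (Cauchy distributor) if it has such a right adjoint (then unique). It is representable by $x\in X$ if $q=p(x,x)$ and $\phi=p(-,x)$. *)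

(* Defs.v *)
(* [0, +oo] is the nonnegative part of \bar R, for R : realType. *)
From HB Require Import structures.
From mathcomp Require Import all_boot all_order all_algebra.
From mathcomp Require Import all_classical all_reals all_analysis.
From mathcomp Require Import lra.

Set Implicit Arguments.
Unset Strict Implicit.
Unset Printing Implicit Defensive.

Import Order.TTheory GRing.Theory Num.Theory.
Import numFieldNormedType.Exports.

Local Open Scope classical_set_scope.
Local Open Scope ring_scope.
Local Open Scope ereal_scope.

(* Because p x x is finite, every difference below subtracts a finite number
   from an element of [0, +oo], so that the indeterminate form +oo - +oo never
   occurs. *)
Record finTypedGPMS (R : realType) := FinTypedGPMS {
  gpms_sort :> Type;
  pm : gpms_sort -> gpms_sort -> \bar R;
  pm_ge0 : forall x y, 0 <= pm x y;
  pm_finite_type : forall x, pm x x < +oo;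
  pm_self : forall x y, maxe (pm x x) (pm y y) <= pm y x;
  pm_triangle : forall x y z, pm z x <= pm z y - pm y y + pm y x
}.

Section CategoricalTopology.
Context {R : realType} {X : finTypedGPMS R}.
Implicit Types (S T : set X) (x : X).

Definition cat_closure S : set X :=
  [set x | ereal_inf [set pm x s - pm s s + pm s x | s in S] <= pm x x].

Definition cat_open S : Prop := cat_closure (~` S) `<=` ~` S.

Lemma pm_fin x : pm x x \is a fin_num.
Proof. by rewrite ge0_fin_numE ?pm_finite_type ?pm_ge0. Qed.

Lemma cat_closureS S T : S `<=` T -> cat_closure S `<=` cat_closure T.
Proof.
by move=> sST x /=; apply: le_trans; apply: ereal_inf_le_tmp; apply: image_subset.
Qed.

Lemma cat_closureP S x : cat_closure S x <->
  forall e : R, (0 < e)%R ->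
    exists2 s, S s & pm x s - pm s s + pm s x < pm x x + e%:E.
Proof.
split=> [Sx e e0|Sx].
- have : ereal_inf [set pm x s - pm s s + pm s x | s in S] < pm x x + e%:E.
    by rewrite (le_lt_trans Sx)// lteDl ?lte_fin ?pm_fin.
  by move=> /ereal_inf_lt[_ [s Ss <-] ?]; exists s.
- apply/lee_addgt0Pr => e e0; have [s Ss /ltW] := Sx e e0.
  by apply: le_trans; apply: ereal_inf_lbound; exists s.
Qed.

Lemma cat_closureU S T :
  cat_closure (S `|` T) `<=` cat_closure S `|` cat_closure T.
Proof.
move=> x; rewrite /cat_closure/= image_setU => STx; apply/orP.
rewrite -ge_min; apply: le_trans STx; apply: le_ereal_inf_tmp => y [|] STy.
- by rewrite ge_min ereal_inf_lbound.
- by rewrite ge_min [X in _ || X]ereal_inf_lbound ?orbT.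
Qed.

Lemma cat_openT : cat_open setT.
Proof.
move=> x; rewrite /cat_closure/= setCT image_set0 ereal_inf0 leye_eq => /eqP xy.
by have := pm_finite_type x; rewrite xy ltxx.
Qed.

Lemma cat_openI : setI_closed cat_open.
Proof.
move=> S T oS oT x; rewrite setCI => /cat_closureU[/oS|/oT] ?; [by left|by right].
Qed.

Lemma cat_open_bigU (I : Type) (f : I -> set X) :
  (forall i, cat_open (f i)) -> cat_open (\bigcup_i f i).
Proof.
move=> of_ x fx [i _ fix_]; apply: (of_ i x) fix_; apply: cat_closureS fx.
by apply: subsetC; apply: bigcup_sup.
Qed.

HB.instance Definition _ := gen_eqMixin (gpms_sort X).
HB.instance Definition _ := gen_choiceMixin (gpms_sort X).
HB.instance Definition _ := isOpenTopological.Build (gpms_sort X)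
  cat_openT cat_openI cat_open_bigU.

End CategoricalTopology.

Section CategoricalClosure.
Context {R : realType} {X : finTypedGPMS R}.
Implicit Types (S : set X) (x : X).

Lemma sub_cat_closure S : S `<=` cat_closure S.
Proof.
move=> x Sx; apply/cat_closureP => e e0; exists x => //.
by rewrite subee ?pm_fin// add0e lteDl ?pm_fin ?lte_fin.
Qed.

Lemma cat_closureK S : cat_closure (cat_closure S) `<=` cat_closure S.
Proof.
move=> x Sx; apply/cat_closureP => e; rewrite (splitr e).
move: (e / 2)%R => {e} h; rewrite -mulr2n pmulrn_lgt0// => h0.
have /cat_closureP/(_ _ h0)[s /cat_closureP/(_ _ h0)[a Sa sa] xs] := Sx.
exists a => //.
have xa := pm_triangle a s x; have ax := pm_triangle x s a.
have := pm_ge0 s a; have := pm_ge0 a s; have := pm_ge0 x s; have := pm_ge0 s x.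
have := pm_ge0 x a; have := pm_ge0 a x.
move: (pm_fin x) (pm_fin s) (pm_fin a) sa xs xa ax.
move: (pm x x) (pm s s) (pm a a) => [u| |]// [v| |]// [w| |]// _ _ _.
move: (pm x a) (pm a x) (pm s a) (pm a s) (pm x s) (pm s x).
move=> [xa| |] [ax| |] [sa| |] [as_| |] [xs| |] [sx| |] //=.
by rewrite -?(EFinN, EFinD, EFinB) ?lee_fin ?lte_fin => *; lra.
Qed.

Lemma cat_closureE S : closure S = cat_closure S.
Proof.
have oE (T : set X) : open T = cat_open T by [].
have oC (T : set X) : open (~` cat_closure T).
  by rewrite oE /cat_open !setCK => x; apply: cat_closureK.
apply/seteqP; split=> x.
- move=> Sx; apply: contrapT => nSx.
  have [s [Ss]] := Sx _ (open_nbhs_nbhs (conj (oC S) nSx)).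
  by apply; exact: sub_cat_closure.
- move=> Sx B /=; rewrite nbhsE => -[U [oU Ux] UB].
  apply: contrapT => SB; have : cat_closure (~` U) x.
    by apply: cat_closureS Sx => s Ss Us; apply: SB; exists s; split => //; exact: UB.
  by move: oU; rewrite oE => oU /oU.
Qed.

End CategoricalClosure.

Section Limits.
Context {R : realType}.

(* -oo is not a value of interest: the metric is only meant on [0, +oo] *)
Definition dsym (a b : \bar R) : \bar R :=
  match a, b with
  | r%:E, s%:E => `|r - s|%:E
  | +oo, +oo => 0
  | _, _ => +oo
  end.

(* Convergence for dsym differs from convergence in the library's topology of
   \bar R: here +oo is an isolated point. *)
Definition ds_cvg (I : Type) (F : set_system I) (u : I -> \bar R)
    (l : \bar R) : Prop :=
  forall e : R, (0 < e)%R -> \forall i \near F, dsym (u i) l < e%:E.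

Definition ds_cauchy (I : Type) (F : set_system I) (u : I -> \bar R) : Prop :=
  forall e : R, (0 < e)%R ->
    \forall i \near F & j \near F, dsym (u i) (u j) < e%:E.

(* arbitrary when the limit does not exist *)
Definition ds_lim (I : Type) (F : set_system I) (u : I -> \bar R) : \bar R :=
  get [set l | ds_cvg F u l].

(* tail filter of the directed set nat * nat *)
Definition oo2 : set_system (nat * nat) := filter_prod \oo \oo.

End Limits.

Section Sequences.
Context {R : realType} {X : finTypedGPMS R}.
Implicit Types x y : nat -> X.

Definition cauchy_sequence x : Prop :=
  ds_cauchy oo2 (fun nm => pm (x nm.1) (x nm.2)).

Definition typed_sequence x : Prop :=
  exists2 q : R, (0 <= q)%R & ds_cvg \oo (fun n => pm (x n) (x n)) q%:E.

Definition equiv_sequence x y : Prop :=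
  [/\ typed_sequence x, typed_sequence y &
    exists l, [/\ ds_cvg \oo (fun n => pm (x n) (y n)) l,
                  ds_cvg \oo (fun n => pm (x n) (x n)) l,
                  ds_cvg \oo (fun n => pm (y n) (y n)) l &
                  ds_cvg \oo (fun n => pm (y n) (x n)) l]].

Definition cauchy_class x : set (nat -> X) :=
  [set y | cauchy_sequence y /\ equiv_sequence x y].

Definition cauchy_classes : set (set (nat -> X)) :=
  [set cauchy_class x | x in cauchy_sequence].

Definition lim_type x : R := fine (ds_lim oo2 (fun nm => pm (x nm.1) (x nm.2))).

Definition lim_presheaf x : X -> \bar R :=
  fun z => ds_lim \oo (fun n => pm z (x n)).

Definition lim_copresheaf x : X -> \bar R :=
  fun z => ds_lim \oo (fun n => pm (x n) z).

End Sequences.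

Section Presheaves.
Context {R : realType} {X : finTypedGPMS R}.
Implicit Types (q : R) (phi psi : X -> \bar R).

(* nonnegativity of the values follows from 0 <= q *)
Definition presheaf q phi : Prop :=
  (0 <= q)%R /\ forall x y : X,
    maxe q%:E (pm y y) <= phi y /\ phi y <= pm y x - pm x x + phi x.

Definition copresheaf q psi : Prop :=
  (0 <= q)%R /\ forall x y : X,
    maxe q%:E (pm y y) <= psi y /\ psi y <= psi x - pm x x + pm x y.

Definition right_adjoint q phi psi : Prop :=
  [/\ presheaf q phi, copresheaf q psi,
      ereal_inf [set psi z - pm z z + phi z | z in [set: X]] <= q%:E &
      forall x y : X, pm y x <= phi y - q%:E + psi x].

Definition cauchy_presheaf q phi : Prop :=
  presheaf q phi /\ exists psi, right_adjoint q phi psi.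

Definition cauchy_presheaves : set (R * (X -> \bar R)) :=
  [set qphi | cauchy_presheaf qphi.1 qphi.2].

Definition representable q phi (x : X) : Prop :=
  q%:E = pm x x /\ phi = (fun y => pm y x).

End Presheaves.

(* Main.v *)
Require Import Defs.
From mathcomp Require Import all_boot all_order all_algebra.
From mathcomp Require Import all_classical all_reals all_analysis.
From mathcomp Require Import lra.

(** All estimates come from two inequalities with the same middle term,
[[
  p z x <= p z y - p y y + p y x      and      p y x <= phi y - q + psi x,
]]
and the subtracted number is always finite, so that both pass to the limit for
the metric [dsym]. Points at a finite [dsym]-distance are both finite or both
infinite; this is why sums, order, squeezing and completeness behave for [dsym]
as they do on the real line, with [+oo] an isolated point.

From sequences to presheaves. For a Cauchy sequence [x] with limit type [q] the
excess [p x_m x_n - p x_m x_m] tends to [0], so the triangle inequality makes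
[p z x_n] and [p x_n z] Cauchy in [n]. Passing to the limit in the axioms of the
space gives the axioms of [phi = lim p - x_n], of [psi = lim p x_n -], and the
second adjunction inequality. The first one, an upper bound on the infimum of
[psi z - p z z + phi z], is witnessed by the sequence itself: [phi x_n],
[psi x_n] and [p x_n x_n] all tend to [q] ([lim_minimizing]).

From presheaves to sequences. If [psi] is right adjoint to [phi], choose [x_n]
such that [psi x_n - p x_n x_n + phi x_n] tends to [q]. As [phi] and [psi] are
bounded below by both [q] and the self-distance, the three terms tend to [q]
separately, and the second adjunction inequality squeezes [p x_n x_m] to [q] and
[p z x_n] to [phi z] ([minimizing_pm], [minimizing_cvg_presheaf]).

Injectivity. If [x] and [y] induce the same [phi], the adjunction of [y] gives
[p x_n x_n <= p x_n y_n <= phi x_n - q + psi_y y_n], where both ends tend to [q];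
so the mixed limits are [q] and [x], [y] are equivalent ([cross_cvg],
[equiv_sequenceP]).

Convergence. The sets of all [s] with [p a s - p s s + p s a < p a a + e] form a
neighbourhood basis of [a], so [x] converges to [a] if and only if
[phi a - q + psi a <= p a a] ([cauchy_cvg_catP]). The lower bounds on [phi] and
[psi] then force [phi a = psi a = q = p a a], and the adjunction identifies
[phi] with [p - a] ([representableP]). *)

Local Open Scope classical_set_scope.

(** * Limits in the extended half-line for the symmetric metric *)

Section Convergence.
Set Implicit Arguments.
Unset Strict Implicit.
Import Order.TTheory GRing.Theory Num.Theory.
Import numFieldNormedType.Exports.
Local Open Scope ring_scope.
Local Open Scope ereal_scope.
Context {R : realType}.
Implicit Types (a b c l m : \bar R) (e : R).

(** Case analysis on two points at a finite distance: the mixed cases, and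
[-oo], are at distance [+oo] from everything. *)
Variant dsym_lt_spec e : \bar R -> \bar R -> Prop :=
  | DsymFin r s of (`|r - s| < e)%R : dsym_lt_spec e r%:E s%:E
  | DsymInfty : dsym_lt_spec e +oo +oo.

Lemma dsym_ltP e a b : dsym a b < e%:E -> dsym_lt_spec e a b.
Proof.
by case: a b => [r| |] [s| |] //=; rewrite ?lte_fin => *; constructor.
Qed.

Lemma dsymC a b : dsym a b = dsym b a.
Proof. by case: a b => [r| |] [s| |] //=; rewrite distrC. Qed.

Lemma dsym_lt_trans e a b c :
  dsym a b < (e / 2)%:E -> dsym b c < (e / 2)%:E -> dsym a c < e%:E.
Proof.
move=> /dsym_ltP[r s rs|]; last first.
  by case: c => //=; rewrite !lte_fin; lra.
case: c => [t| |] //=; rewrite !lte_fin => st.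
by rewrite (splitr e) (le_lt_trans (ler_distD s _ _))// ltrD.
Qed.

Section Filtered.
Context {I : Type} {F : set_system I}.
Implicit Types u v w : I -> \bar R.

Lemma ds_cvg_cst {FF : Filter F} a : 0 <= a -> ds_cvg F (fun=> a) a.
Proof.
case: a => [r| |]// _ e e0; apply: nearW => i /=; rewrite ?lte_fin//.
by rewrite subrr normr0.
Qed.

Lemma ds_cvg_unique {FF : ProperFilter F} u l m :
  ds_cvg F u l -> ds_cvg F u m -> l = m.
Proof.
move=> ul um.
have lm e : (0 < e)%R -> dsym l m < e%:E.
  move=> e0; have h0 : (0 < e / 2)%R by rewrite divr_gt0.
  have [i [uli umi]] := filter_ex (filterI (ul _ h0) (um _ h0)).
  by apply: (@dsym_lt_trans _ _ (u i)) => //; rewrite dsymC.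
move: lm {ul um}; case: l m => [r| |] [s| |] lm //; try by have := lm 1%R ltr01.
congr (_%:E); apply/eqP; rewrite -subr_eq0 -normr_le0; apply/ler_addgt0Pr => e e0.
by rewrite add0r ltW// -lte_fin; exact: lm.
Qed.

Lemma ds_lim_cvg u l : ds_cvg F u l -> ds_cvg F u (ds_lim F u).
Proof. by move=> ul; apply: (@getPex _ [set l | ds_cvg F u l]); exists l. Qed.

Lemma ds_lim_eq {FF : ProperFilter F} u l : ds_cvg F u l -> ds_lim F u = l.
Proof. by move=> ul; apply: (ds_cvg_unique (ds_lim_cvg ul) ul). Qed.

Lemma ds_cvgD {FF : Filter F} u v l m :
  ds_cvg F u l -> ds_cvg F v m -> ds_cvg F (fun i => u i + v i) (l + m).
Proof.
move=> ul vm e e0; have h0 : (0 < e / 2)%R by rewrite divr_gt0.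
apply: filterS2 (ul _ h0) (vm _ h0) => i /dsym_ltP uli /dsym_ltP vmi.
case: uli => [r s rs|]; case: vmi => [r' s' rs'|] //=; rewrite lte_fin//.
by rewrite opprD addrACA (splitr e) (le_lt_trans (ler_normD _ _))// ltrD.
Qed.

(** Finiteness matters here: negation would send the limit [+oo] to [-oo], to
which nothing converges. *)
Lemma ds_cvgN u l :
  l \is a fin_num -> ds_cvg F u l -> ds_cvg F (fun i => - u i) (- l).
Proof.
case: l => [q| |]// _ uq e e0.
have dsymN a : dsym (- a) (- q%:E) = dsym a q%:E.
  by case: a => [r| |] //=; rewrite -opprD normrN.
by under eq_near do rewrite dsymN; exact: uq.
Qed.

(** The right-hand sides of the triangle inequality and of the adjunction
inequality have this form; [m] is the limit of self-distances, or a type. *)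
Lemma ds_cvgBD {FF : Filter F} u v w l m n : m \is a fin_num ->
  ds_cvg F u l -> ds_cvg F v m -> ds_cvg F w n ->
  ds_cvg F (fun i => u i - v i + w i) (l - m + n).
Proof.
by move=> mfin ul vm wn; apply: ds_cvgD wn; apply: ds_cvgD ul (ds_cvgN mfin vm).
Qed.

Lemma ds_cvg_le {FF : ProperFilter F} u v l m :
  (\forall i \near F, u i <= v i) -> ds_cvg F u l -> ds_cvg F v m -> l <= m.
Proof.
move=> uv ul vm; apply/lee_addgt0Pr => e e0.
have h0 : (0 < e / 2)%R by rewrite divr_gt0.
have [i [[]]] := filter_ex (filterI (filterI uv (ul _ h0)) (vm _ h0)).
move=> + /dsym_ltP uli /dsym_ltP vmi.
case: uli => [r s rs|]; case: vmi => [r' s' rs'|] //=; rewrite ?leey//.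
rewrite -EFinD !lee_fin => rr'; move: rs rs'.
by rewrite !ltr_distl => /andP[? ?] /andP[? ?]; lra.
Qed.

Lemma ds_squeeze {FF : ProperFilter F} u v w l :
  (\forall i \near F, u i <= v i) -> (\forall i \near F, v i <= w i) ->
  ds_cvg F u l -> ds_cvg F w l -> ds_cvg F v l.
Proof.
move=> uv vw ul wl e e0.
apply: filterS3 (filterI uv vw) (ul _ e0) (wl _ e0) => i [].
move: (u i) (v i) (w i) l {ul wl} => [r| |] [s| |] [t| |] [k| |] //=.
rewrite !lee_fin !lte_fin !ltr_distl => ? ? /andP[? ?] /andP[? ?].
by apply/andP; split; lra.
Qed.

(** Completeness: comparing with one fixed value shows that a Cauchy family is
either eventually real, and then completeness of the real line applies, or
eventually constant equal to [+oo]. *)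
Lemma ds_cauchy_cvg {FF : ProperFilter F} u :
  ds_cauchy F u -> exists l, ds_cvg F u l.
Proof.
move=> uC.
have near_point e : (0 < e)%R ->
    exists k, \forall i \near F, dsym (u k) (u i) < e%:E.
  move=> /uC[[A B] /= [FA FB] AB]; have [k Ak] := filter_ex FA.
  by exists k; apply: filterS FB => i Bi; exact: (AB (k, i)).
have [k uk] := near_point _ ltr01.
case: (u k) uk => [r| |] uk.
- have ufin : \forall i \near F, u i = (fine (u i))%:E.
    by apply: filterS uk => i; case: (u i).
  have /cvg_ex[l ul] : cvg ((fine \o u) @ F).
    apply/cauchy_cvgP/cauchyP => e e0.
    have [j uj] := near_point _ e0; exists (fine (u j)).
    apply: filterS2 ufin uj => i /= ui; rewrite ui.
    by case: (u j) => [s| |] //=; rewrite lte_fin.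
  exists l%:E => e e0; move/cvgrPdist_lt: ul => /(_ _ e0).
  by apply: filterS2 ufin => i -> /=; rewrite distrC lte_fin.
- by exists +oo => e e0; apply: filterS uk => i; case: (u i) => //=; rewrite !lte_fin.
- by have [i] := filter_ex uk.
Qed.

Lemma ds_cvg_cauchy {FF : Filter F} u l : ds_cvg F u l -> ds_cauchy F u.
Proof.
move=> ul e e0; have h0 : (0 < e / 2)%R by rewrite divr_gt0.
exists ([set i | dsym (u i) l < (e / 2)%:E], [set i | dsym (u i) l < (e / 2)%:E]).
  by split; exact: ul.
by case=> i j [/= ui uj]; apply: (dsym_lt_trans ui); rewrite dsymC.
Qed.

(** The triangle inequality only provides one-sided estimates; exchanging the two
indices gives the other side. *)
Lemma ds_cauchy_le {FF : Filter F} u : (forall i, 0 <= u i) ->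
  (forall e, (0 < e)%R -> \forall i \near F & j \near F, u i <= u j + e%:E) ->
  ds_cauchy F u.
Proof.
move=> u0 uij e e0; have /uij : (0 < e / 2)%R by rewrite divr_gt0.
move=> uij1; have := uij1; rewrite near_swap => uij2.
apply: filterS2 uij1 uij2 => -[i j] /=.
move: (u i) (u j) (u0 i) (u0 j) => [r| |] [s| |] //= _ _; rewrite !lte_fin//.
by rewrite !lee_fin ltr_distl => ? ?; apply/andP; split; lra.
Qed.

Lemma ds_cvg_near_le {FF : Filter F} u (q e : R) :
  (0 < e)%R -> ds_cvg F u q%:E -> \forall i \near F, u i <= (q + e)%:E.
Proof.
move=> e0 /(_ _ e0); apply: filterS => i; case: (u i) => [r| |] //=.
by rewrite lte_fin lee_fin ltr_distl => /andP[_ /ltW].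
Qed.

Lemma ds_cvg_comp {J : Type} {G : set_system J} (f : J -> I) u l :
  f @ G --> F -> ds_cvg F u l -> ds_cvg G (u \o f) l.
Proof. by move=> fGF ul e e0; exact: fGF (ul e e0). Qed.

Lemma ds_cvg_EFin {FF : Filter F} (u : I -> R) (q : R) :
  u @ F --> q -> ds_cvg F (EFin \o u) q%:E.
Proof.
move=> /cvgrPdist_lt uq e e0; apply: filterS (uq e e0) => i.
by rewrite distrC /= lte_fin.
Qed.

End Filtered.

(** A double limit can be computed as an iterated one as soon as the inner limits
exist. This gives the values of a limit presheaf along its own sequence. *)
Lemma ds_cvg_iterated {I J : Type} {F : set_system I} {G : set_system J}
    {FF : ProperFilter F} {FG : ProperFilter G}
    (u : I * J -> \bar R) (v : I -> \bar R) l :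
  ds_cvg (filter_prod F G) u l ->
  (forall i, ds_cvg G (fun j => u (i, j)) (v i)) -> ds_cvg F v l.
Proof.
move=> ul uv e e0; have h0 : (0 < e / 2)%R by rewrite divr_gt0.
have /nearP_dep uFG :
    \forall i \near F & j \near G, dsym (u (i, j)) l < (e / 2)%:E.
  by apply: filterS (ul _ h0) => -[].
apply: filterS uFG => i uil.
have [j [uijl uijv]] := filter_ex (filterI uil (uv i _ h0)).
by apply: dsym_lt_trans uijl; rewrite dsymC.
Qed.

Lemma ds_cvg_swap (u : nat * nat -> \bar R) l :
  ds_cvg oo2 u l -> ds_cvg oo2 (fun nm => u (nm.2, nm.1)) l.
Proof.
apply: (@ds_cvg_comp _ _ _ _ (fun nm : nat * nat => (nm.2, nm.1))).
exact: (@cvg_pair _ _ _ oo2 \oo \oo _ _ _ snd fst cvg_snd cvg_fst).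
Qed.

Lemma ds_cvg_diag (u : nat * nat -> \bar R) l :
  ds_cvg oo2 u l -> ds_cvg \oo (fun n => u (n, n)) l.
Proof.
apply: (@ds_cvg_comp _ _ _ _ (fun n => (n, n))).
exact: (cvg_pair cvg_id cvg_id).
Qed.

End Convergence.

(** * Adjoint presheaves and their minimizing sequences *)

Section Adjunctions.
Set Implicit Arguments.
Unset Strict Implicit.
Import Order.TTheory GRing.Theory Num.Theory.
Import numFieldNormedType.Exports.
Local Open Scope ring_scope.
Local Open Scope ereal_scope.
Context {R : realType} {X : finTypedGPMS R}.
Implicit Types (x y : nat -> X) (z w : X) (q : R) (phi psi : X -> \bar R).

Lemma pm_selfl z w : pm z z <= pm z w.
Proof. by apply: le_trans (pm_self w z); rewrite le_max lexx orbT. Qed.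

Lemma pm_selfr z w : pm w w <= pm z w.
Proof. by apply: le_trans (pm_self w z); rewrite le_max lexx. Qed.

(** The sequence realizes the unit inequality of the adjunction in the limit; the
notion serves to recover a Cauchy sequence from a Cauchy presheaf. *)
Definition minimizing phi psi q x : Prop :=
  ds_cvg \oo (fun n => psi (x n) - pm (x n) (x n) + phi (x n)) q%:E.

Section Minimizing.
Variables (q : R) (phi psi : X -> \bar R) (x : nat -> X).
Hypotheses (adj : right_adjoint q phi psi) (xmin : minimizing phi psi q x).

Let phi_ge z : maxe q%:E (pm z z) <= phi z.
Proof. by case: adj => -[_ /(_ z z)[]]. Qed.

Let psi_ge z : maxe q%:E (pm z z) <= psi z.
Proof. by case: adj => _ [_ /(_ z z)[]]. Qed.

(** The remainder [psi - p] of the minimized sum is nonnegative. *)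
Lemma minimizing_presheaf : ds_cvg \oo (phi \o x) q%:E.
Proof.
apply: ds_squeeze (ds_cvg_cst _) xmin; last by rewrite lee_fin; case: adj => -[].
- by apply: nearW => n /=; apply: le_trans (phi_ge _); rewrite le_max lexx.
- apply: nearW => n /=; rewrite leeDr// sube_ge0 ?pm_fin//.
  by apply: le_trans (psi_ge _); rewrite le_max lexx orbT.
Qed.

Lemma minimizing_copresheaf : ds_cvg \oo (psi \o x) q%:E.
Proof.
apply: ds_squeeze (ds_cvg_cst _) xmin; last by rewrite lee_fin; case: adj => -[].
- by apply: nearW => n /=; apply: le_trans (psi_ge _); rewrite le_max lexx.
- apply: nearW => n /=; rewrite -addeA leeDl// addeC sube_ge0 ?pm_fin//.
  by apply: le_trans (phi_ge _); rewrite le_max lexx orbT.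
Qed.

(** Where the values are finite, the self-distance is [psi + phi] minus the
minimized sum, hence tends to [q + q - q]. *)
Lemma minimizing_self : ds_cvg \oo (fun n => pm (x n) (x n)) q%:E.
Proof.
have qE : q%:E + q%:E - q%:E = q%:E by rewrite addeK.
apply: (@ds_squeeze _ _ _ _ (fun n => psi (x n) + phi (x n) -
  (psi (x n) - pm (x n) (x n) + phi (x n))) _ (phi \o x)).
  (* An equality for finite values; an inequality remains when some value is
     infinite, since the left-hand side is then [-oo]. *)
- apply: nearW => n /=; move: (pm_fin (x n)).
  move: (psi _) (phi _) (pm _ _) => [r| |] [s| |] [t| |] //= _;
    rewrite ?addeNy ?addNye ?leNye//.
  by rewrite -?EFinD !lee_fin; lra.
- by apply: nearW => n /=; apply: le_trans (phi_ge _); rewrite le_max lexx orbT.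
- rewrite -qE; apply: ds_cvgD; last exact: ds_cvgN.
  exact: ds_cvgD minimizing_copresheaf minimizing_presheaf.
- exact: minimizing_presheaf.
Qed.

(** Such a sequence is Cauchy: the adjunction bounds [p x_n x_m] above by
[phi x_n - q + psi x_m], the self-distance bounds it below. *)
Lemma minimizing_pm : ds_cvg oo2 (fun nm => pm (x nm.1) (x nm.2)) q%:E.
Proof.
have qE : q%:E - q%:E + q%:E = q%:E by rewrite subeK.
apply: (@ds_squeeze _ _ _ _ (fun nm => pm (x nm.1) (x nm.1)) _
  (fun nm => phi (x nm.1) - q%:E + psi (x nm.2))).
- by apply: nearW => nm; exact: pm_selfl.
- by apply: nearW => nm; case: adj => _ _ _; exact.
- exact: ds_cvg_comp cvg_fst minimizing_self.
- rewrite -{2}qE; apply: ds_cvgBD => //; last 2 first.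
  + by apply: ds_cvg_cst; rewrite lee_fin; case: adj => -[].
  + exact: ds_cvg_comp cvg_snd minimizing_copresheaf.
  + exact: ds_cvg_comp cvg_fst minimizing_presheaf.
Qed.

(** The bounds are those saying that [phi] is a presheaf (lower) and that it is
adjoint to [psi] (upper). *)
Lemma minimizing_cvg_presheaf z : ds_cvg \oo (fun n => pm z (x n)) (phi z).
Proof.
have q0 : 0 <= q%:E by rewrite lee_fin; case: adj => -[].
have phi0 : 0 <= phi z by apply: le_trans (phi_ge _); rewrite le_max q0.
apply: (@ds_squeeze _ _ _ _ (fun n => phi z - phi (x n) + pm (x n) (x n)) _
  (fun n => phi z - q%:E + psi (x n))).
  (* The presheaf inequality [phi z <= p z x_n - p x_n x_n + phi x_n], solved for
     [p z x_n]; for infinite [phi x_n] the lower bound is [-oo]. *)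
- apply: nearW => n; case: adj => -[_ /(_ (x n) z)[_ h]] _ _ _.
  move: h (pm_fin (x n)) (pm_ge0 z (x n)).
  move: (phi z) (phi (x n)) (pm (x n) (x n)) (pm z (x n)).
  move=> [r| |] [s| |] [t| |] [k| |] //=; rewrite ?(addeNy, addNye, leNye, leey)//.
  by rewrite -?(EFinN, EFinD, EFinB) ?lee_fin => *; lra.
- by apply: nearW => n; case: adj => _ _ _; exact.
- rewrite -[phi z in X in ds_cvg _ _ X](@subeK _ _ q%:E)//.
  apply: ds_cvgBD => //; first exact: ds_cvg_cst.
  + exact: minimizing_presheaf.
  + exact: minimizing_self.
- rewrite -[phi z in X in ds_cvg _ _ X](@subeK _ _ q%:E)//.
  apply: ds_cvgBD => //; [exact: ds_cvg_cst|exact: ds_cvg_cst|].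
  exact: minimizing_copresheaf.
Qed.

End Minimizing.

Lemma right_adjoint_minimizing q phi psi :
  right_adjoint q phi psi -> exists x, minimizing phi psi q x.
Proof.
case=> -[q0 phiP] [_ psiP] inf_le _.
have /choice[x xP] : forall n, exists z,
    psi z - pm z z + phi z < q%:E + (harmonic n)%:E.
  move=> n; have : ereal_inf [set psi z - pm z z + phi z | z in [set: X]]
      < q%:E + (harmonic n)%:E.
    by apply: (le_lt_trans inf_le); rewrite lteDl// lte_fin harmonic_gt0.
  by move=> /ereal_inf_lt[_ [z _ <-] ?]; exists z.
exists x; apply: (@ds_squeeze _ _ _ _ (fun=> q%:E) _
  (fun n => q%:E + (harmonic n)%:E)).
- apply: nearW => n; have [+ _] := phiP (x n) (x n); have [+ _] := psiP (x n) (x n).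
  rewrite !ge_max => /andP[_ psig] /andP[phig _].
  by apply: (le_trans phig); rewrite leeDr// sube_ge0// pm_fin.
- by apply: nearW => n; exact: ltW.
- by apply: ds_cvg_cst; rewrite lee_fin.
- rewrite -{2}[q%:E]adde0; apply: ds_cvgD; first by apply: ds_cvg_cst; rewrite lee_fin.
  exact: ds_cvg_EFin cvg_harmonic.
Qed.

(** * The adjunction of a Cauchy sequence *)

Section CauchyLimits.
Variable x : nat -> X.
Hypothesis xC : cauchy_sequence x.

(** The limit cannot be [+oo], since the self-distances on the diagonal are
finite. *)
Lemma cauchy_cvg_type :
  ds_cvg oo2 (fun nm => pm (x nm.1) (x nm.2)) (lim_type x)%:E.
Proof.
have [l xl] := ds_cauchy_cvg xC; have := ds_cvg_diag xl.
rewrite /lim_type (ds_lim_eq xl) => /(_ _ ltr01)/filter_ex[n].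
by case: l xl => //= xl; move: (pm_fin (x n)); case: (pm _ _).
Qed.

Lemma cauchy_cvg_self : ds_cvg \oo (fun n => pm (x n) (x n)) (lim_type x)%:E.
Proof. exact: (ds_cvg_diag cauchy_cvg_type). Qed.

Lemma lim_type_ge0 : (0 <= lim_type x)%R.
Proof.
rewrite -lee_fin; apply: ds_cvg_le (ds_cvg_cst _) cauchy_cvg_self => //.
by apply: nearW => n; exact: pm_ge0.
Qed.

(** Applied to [p x_n x_m] and to [p x_m x_n]: the correction terms in the
triangle inequality through [x_m] become negligible. *)
Lemma cauchy_excess (u : nat * nat -> \bar R) :
  ds_cvg oo2 u (lim_type x)%:E ->
  ds_cvg oo2 (fun nm => u nm - pm (x nm.2) (x nm.2)) 0.
Proof.
move=> uq; rewrite -(@subee _ (lim_type x)%:E)//; apply: ds_cvgD uq _.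
by apply: ds_cvgN => //; exact: ds_cvg_comp cvg_snd cauchy_cvg_self.
Qed.

Lemma cauchy_cvg_presheaf z : ds_cvg \oo (fun n => pm z (x n)) (lim_presheaf x z).
Proof.
have [|l] := @ds_cauchy_cvg _ _ \oo _ (fun n => pm z (x n)); last exact: ds_lim_cvg.
apply: ds_cauchy_le => [n|e e0]; first exact: pm_ge0.
apply: filterS (ds_cvg_near_le e0 (cauchy_excess (ds_cvg_swap cauchy_cvg_type))).
move=> -[n m] /=; rewrite add0r => mn.
apply: (le_trans (pm_triangle (x n) (x m) z)).
by rewrite -addeA leeD2l// addeC.
Qed.

Lemma cauchy_cvg_copresheaf z :
  ds_cvg \oo (fun n => pm (x n) z) (lim_copresheaf x z).
Proof.
have [|l] := @ds_cauchy_cvg _ _ \oo _ (fun n => pm (x n) z); last exact: ds_lim_cvg.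
apply: ds_cauchy_le => [n|e e0]; first exact: pm_ge0.
apply: filterS (ds_cvg_near_le e0 (cauchy_excess cauchy_cvg_type)).
move=> -[n m] /=; rewrite add0r => mn.
apply: (le_trans (pm_triangle z (x m) (x n))).
by rewrite [leRHS]addeC leeD2r.
Qed.

Lemma lim_presheafP : presheaf (lim_type x) (lim_presheaf x).
Proof.
split=> [|w z]; first exact: lim_type_ge0; split.
- rewrite ge_max; apply/andP; split.
  + apply: ds_cvg_le cauchy_cvg_self (cauchy_cvg_presheaf z).
    by apply: nearW => n; exact: pm_selfr.
  + apply: ds_cvg_le (ds_cvg_cst (pm_ge0 z z)) (cauchy_cvg_presheaf z).
    by apply: nearW => n; exact: pm_selfl.
- apply: ds_cvg_le (cauchy_cvg_presheaf z)
    (ds_cvgBD (pm_fin w) (ds_cvg_cst (pm_ge0 z w)) (ds_cvg_cst (pm_ge0 w w))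
      (cauchy_cvg_presheaf w)).
  by apply: nearW => n; exact: pm_triangle.
Qed.

Lemma lim_copresheafP : copresheaf (lim_type x) (lim_copresheaf x).
Proof.
split=> [|w z]; first exact: lim_type_ge0; split.
- rewrite ge_max; apply/andP; split.
  + apply: ds_cvg_le cauchy_cvg_self (cauchy_cvg_copresheaf z).
    by apply: nearW => n; exact: pm_selfl.
  + apply: ds_cvg_le (ds_cvg_cst (pm_ge0 z z)) (cauchy_cvg_copresheaf z).
    by apply: nearW => n; exact: pm_selfr.
- apply: ds_cvg_le (cauchy_cvg_copresheaf z)
    (ds_cvgBD (pm_fin w) (cauchy_cvg_copresheaf w) (ds_cvg_cst (pm_ge0 w w))
      (ds_cvg_cst (pm_ge0 w z))).
  by apply: nearW => n; exact: pm_triangle.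
Qed.

Lemma lim_presheaf_self :
  ds_cvg \oo (fun n => lim_presheaf x (x n)) (lim_type x)%:E.
Proof.
by apply: ds_cvg_iterated cauchy_cvg_type _ => n; exact: (cauchy_cvg_presheaf (x n)).
Qed.

Lemma lim_copresheaf_self :
  ds_cvg \oo (fun n => lim_copresheaf x (x n)) (lim_type x)%:E.
Proof.
apply: ds_cvg_iterated (ds_cvg_swap cauchy_cvg_type) _ => n.
exact: (cauchy_cvg_copresheaf (x n)).
Qed.

Lemma lim_minimizing :
  minimizing (lim_presheaf x) (lim_copresheaf x) (lim_type x) x.
Proof.
rewrite /minimizing -[_%:E](@subeK _ _ (lim_type x)%:E)//.
exact: ds_cvgBD lim_copresheaf_self cauchy_cvg_self lim_presheaf_self.
Qed.

Lemma lim_right_adjoint :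
  right_adjoint (lim_type x) (lim_presheaf x) (lim_copresheaf x).
Proof.
split; [exact: lim_presheafP|exact: lim_copresheafP| |move=> w z].
- apply/lee_addgt0Pr => e e0.
  have [n] := filter_ex (ds_cvg_near_le e0 lim_minimizing).
  by apply: le_trans; apply: ereal_inf_lbound; exists (x n).
- apply: ds_cvg_le (ds_cvg_cst (pm_ge0 z w)) (ds_cvgBD _ (cauchy_cvg_presheaf z)
    cauchy_cvg_self (cauchy_cvg_copresheaf w)) => //.
  by apply: nearW => n; exact: pm_triangle.
Qed.

End CauchyLimits.

(** * Equivalent sequences have the same presheaf *)

Definition lim_data x : R * (X -> \bar R) := (lim_type x, lim_presheaf x).

Lemma lim_dataE q phi x :
  ds_cvg oo2 (fun nm => pm (x nm.1) (x nm.2)) q%:E ->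
  (forall z, ds_cvg \oo (fun n => pm z (x n)) (phi z)) ->
  lim_data x = (q, phi).
Proof.
move=> xq xphi; congr (_, _); first by rewrite /lim_type (ds_lim_eq xq).
by apply/funext => z; exact: ds_lim_eq.
Qed.

(** The triangle inequality through [x_n] at the limit: the mixed distances and
the self-distances of [x] have the same limit and cancel. *)
Lemma lim_presheaf_le x y : cauchy_sequence x -> cauchy_sequence y ->
  ds_cvg \oo (fun n => pm (x n) (y n)) (lim_type x)%:E ->
  forall z, lim_presheaf y z <= lim_presheaf x z.
Proof.
move=> xC yC xy z; rewrite -[leRHS](@subeK _ _ (lim_type x)%:E)//.
apply: ds_cvg_le (cauchy_cvg_presheaf yC z) (ds_cvgBD _ (cauchy_cvg_presheaf xC z)
  (cauchy_cvg_self xC) xy) => //.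
by apply: nearW => n; exact: pm_triangle.
Qed.

(** The adjunction inequality of [y], evaluated at [x_n] and [y_n], bounds the
mixed distance by values of [phi] along [x], which tend to [q] because [phi] is
also the presheaf of [x]. *)
Lemma cross_cvg x y : cauchy_sequence x -> cauchy_sequence y ->
  lim_data x = lim_data y ->
  ds_cvg \oo (fun n => pm (x n) (y n)) (lim_type x)%:E.
Proof.
move=> xC yC [qE phiE].
apply: (@ds_squeeze _ _ _ _ (fun n => pm (x n) (x n)) _
  (fun n => lim_presheaf x (x n) - (lim_type x)%:E + lim_copresheaf y (y n))).
- by apply: nearW => n; exact: pm_selfl.
- rewrite phiE qE; apply: nearW => n.
  by have [_ _ _] := lim_right_adjoint yC; exact.
- exact: cauchy_cvg_self.
- rewrite -[X in ds_cvg _ _ X](@subeK _ _ (lim_type x)%:E)//.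
  apply: ds_cvgBD => //; first exact: lim_presheaf_self.
    by apply: ds_cvg_cst; rewrite lee_fin lim_type_ge0.
  by rewrite qE; exact: lim_copresheaf_self.
Qed.

Lemma equiv_sequenceP x y : cauchy_sequence x -> cauchy_sequence y ->
  equiv_sequence x y <-> lim_data x = lim_data y.
Proof.
move=> xC yC; split=> [[_ _ [l [xy xx yy yx]]]|xyE].
- have lx : l = (lim_type x)%:E by exact: ds_cvg_unique xx (cauchy_cvg_self xC).
  have ly : l = (lim_type y)%:E by exact: ds_cvg_unique yy (cauchy_cvg_self yC).
  congr (_, _); first by case: (etrans (esym lx) ly).
  apply/funext => z; apply/eqP.
  by rewrite eq_le !lim_presheaf_le// -?ly// -lx.
- split; [exists (lim_type x)|exists (lim_type y)|exists (lim_type x)%:E; split].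
  + exact: lim_type_ge0.
  + exact: cauchy_cvg_self.
  + exact: lim_type_ge0.
  + exact: cauchy_cvg_self.
  + exact: cross_cvg.
  + exact: cauchy_cvg_self.
  + by case: xyE => -> _; exact: cauchy_cvg_self.
  + by case: (xyE) => -> _; exact: cross_cvg.
Qed.

Lemma cauchy_classP x y : cauchy_sequence x -> cauchy_sequence y ->
  cauchy_class x = cauchy_class y <-> lim_data x = lim_data y.
Proof.
move=> xC yC; split=> [xyE|xyE].
- have [_ /equiv_sequenceP->//] : cauchy_class x y.
  by rewrite xyE; split=> //; exact/equiv_sequenceP.
- by apply/seteqP; split=> w [wC] /equiv_sequenceP h; split=> //;
    apply/equiv_sequenceP => //; rewrite ?xyE ?h// -xyE h.
Qed.

(** * Convergence for the categorical topology *)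

Lemma nbhs_catP (a : X) (U : set X) : nbhs a U <->
  exists2 e : R, (0 < e)%R &
    [set s | pm a s - pm s s + pm s a < pm a a + e%:E] `<=` U.
Proof.
have -> : nbhs a U <-> ~ cat_closure (~` U) a.
  by rewrite -cat_closureE closure_setC; split=> [aU|/contrapT//]; exact.
rewrite cat_closureP; split=> [|[e e0 eU] /(_ e e0)[s Us /eU//]].
move=> /existsNP[e /not_implyP[e0 eU]]; exists e => // s se.
by apply: contrapT => Us; apply: eU; exists s.
Qed.

Lemma cvg_catP x (a : X) : x @ \oo --> a <-> forall e : R, (0 < e)%R ->
  \forall n \near \oo, pm a (x n) - pm (x n) (x n) + pm (x n) a < pm a a + e%:E.
Proof.
split=> [xa e e0|xa U /nbhs_catP[e e0 eU]].
- have /xa : nbhs a [set s | pm a s - pm s s + pm s a < pm a a + e%:E] by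
    apply/nbhs_catP; exists e.
  exact.
- by apply: filterS (xa e e0) => n; exact: eU.
Qed.

Lemma cauchy_cvg_catP x (a : X) : cauchy_sequence x ->
  x @ \oo --> a <-> lim_presheaf x a - (lim_type x)%:E + lim_copresheaf x a <= pm a a.
Proof.
move=> xC.
have lim : ds_cvg \oo (fun n => pm a (x n) - pm (x n) (x n) + pm (x n) a)
    (lim_presheaf x a - (lim_type x)%:E + lim_copresheaf x a).
  exact: ds_cvgBD (cauchy_cvg_presheaf xC a) (cauchy_cvg_self xC)
    (cauchy_cvg_copresheaf xC a).
rewrite cvg_catP; split=> [xa|le_a e e0].
- apply/lee_addgt0Pr => e e0; apply: ds_cvg_le lim (ds_cvg_cst _).
    by apply: filterS (xa e e0) => n /ltW.
  by rewrite adde_ge0 ?pm_ge0// lee_fin ltW.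
- have h0 : (0 < e / 2)%R by rewrite divr_gt0.
  move: lim le_a; case: (_ + _) => [r| |] lim le_a; first 1 last.
  + by move: le_a (pm_fin a); rewrite leye_eq => /eqP->.
  + by have [n] := filter_ex (lim _ ltr01); case: (_ + _).
  apply: filterS (ds_cvg_near_le h0 lim) => n /le_lt_trans; apply.
  rewrite EFinD (@le_lt_trans _ _ (pm a a + (e / 2)%:E)) ?leeD2r//.
  by rewrite lteD2lE ?pm_fin// lte_fin; lra.
Qed.

(** If [phi = p - a], every term of the infimum in the adjunction is at least
[psi a] since [psi] is covariant, whence [psi a <= q]. Conversely [q] and [p a a]
are lower bounds of both [phi a] and [psi a], so the inequality forces all four
to be equal, and the triangle and adjunction inequalities at [a] sandwich
[phi]. *)
Lemma representableP x (a : X) : cauchy_sequence x ->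
  representable (lim_type x) (lim_presheaf x) a <->
  lim_presheaf x a - (lim_type x)%:E + lim_copresheaf x a <= pm a a.
Proof.
move=> xC; have [[q0 phiP] [_ psiP] inf_le pm_le] := lim_right_adjoint xC.
set q := (lim_type x)%:E in inf_le pm_le *.
split=> [[qE phiE]|le_a].
- have -> : lim_presheaf x a = q by rewrite phiE.
  rewrite subee// add0e -qE; apply: le_trans inf_le.
  apply: le_ereal_inf_tmp => _ [z _ <-]; rewrite phiE.
  by have [_] := psiP z a.
- have [+ _] := phiP a a; have [+ _] := psiP a a.
  rewrite !ge_max => /andP[q_psi pm_psi] /andP[q_phi pm_phi].
  have [phi_q psi_q qE] :
      [/\ lim_presheaf x a = q, lim_copresheaf x a = q & q = pm a a].
    move: le_a q_psi pm_psi q_phi pm_phi (pm_fin a); rewrite /q.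
    move: (lim_presheaf x a) (lim_copresheaf x a) (pm a a).
    move=> [r| |] [s| |] [t| |]//=; rewrite !lee_fin => *.
    by split; congr (_%:E); lra.
  split=> //; apply/funext => z; apply/eqP; rewrite eq_le; apply/andP; split.
  + by have [_] := phiP a z; rewrite phi_q qE subeK ?pm_fin.
  + by have := pm_le a z; rewrite psi_q subeK.
Qed.

End Adjunctions.

Theorem theorem5p3p6 (R : realType) (X : finTypedGPMS R) :
  (forall x : nat -> X, cauchy_sequence x ->
    [/\ ds_cvg oo2 (fun nm => pm (x nm.1) (x nm.2)) (lim_type x)%:E,
        (forall y, ds_cvg \oo (fun n => pm y (x n)) (lim_presheaf x y)),
        (forall y, ds_cvg \oo (fun n => pm (x n) y) (lim_copresheaf x y)),
        cauchy_presheaf (lim_type x) (lim_presheaf x) &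
        right_adjoint (lim_type x) (lim_presheaf x) (lim_copresheaf x)]) /\
  (exists f : set (nat -> X) -> R * (X -> \bar R),
    (forall x : nat -> X, cauchy_sequence x ->
       f (cauchy_class x) = (lim_type x, lim_presheaf x)) /\
    set_bij cauchy_classes cauchy_presheaves f) /\
  (forall (x : nat -> X) (a : X), cauchy_sequence x ->
    (x @ \oo --> a <-> representable (lim_type x) (lim_presheaf x) a)).
Proof.
split=> [x xC|].
  split; [exact: cauchy_cvg_type|exact: cauchy_cvg_presheaf|
    exact: cauchy_cvg_copresheaf| |exact: lim_right_adjoint].
  by split; [exact: lim_presheafP|exists (lim_copresheaf x); exact: lim_right_adjoint].
split=> [|x a xC]; last by rewrite cauchy_cvg_catP// representableP.
(* Off the set of classes [f] takes an arbitrary value. *)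
have /choice[f fP] : forall S : set (nat -> X), exists d, forall x,
    cauchy_sequence x -> S = cauchy_class x -> d = lim_data x.
  move=> S; have [[x [xC ->]]|noS] :=
      pselect (exists x, cauchy_sequence x /\ S = cauchy_class x).
    by exists (lim_data x) => y yC /cauchy_classP; exact.
  by exists (0%R, fun=> 0%E) => x xC SE; case: noS; exists x.
have fE x : cauchy_sequence x -> f (cauchy_class x) = lim_data x.
  by move=> xC; exact: fP.
exists f; split=> //; split.
- move=> _ [x xC <-]; rewrite fE//; split; first exact: lim_presheafP.
  by exists (lim_copresheaf x); exact: lim_right_adjoint.
- move=> _ _ /set_mem[x xC <-] /set_mem[y yC <-]; rewrite !fE// => xy.
  exact/cauchy_classP.
- move=> [q phi] [_ [psi /= adj]].
  have [x xmin] := right_adjoint_minimizing adj.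
  have xC : cauchy_sequence x by exact: ds_cvg_cauchy (minimizing_pm adj xmin).
  exists (cauchy_class x); first by exists x.
  rewrite fE//; apply: lim_dataE; first exact: minimizing_pm adj xmin.
  exact: minimizing_cvg_presheaf adj xmin.
Qed.
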